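(* $$\frac{16}{4+\pi^2}=\mathrm{CF}\left[3n^2+3n+1,\,-n^3(2n-3)\right].$$
   Context: For sequences $(a_n)_{n\ge0}$, $(b_n)_{n\ge1}$, $\mathrm{CF}[a_n,b_n]$ denotes the continued fraction $a_0+\cfrac{b_1}{a_1+\cfrac{b_2}{a_2+\ddots}}$, whose value is $\lim_{n\to\infty}A_n/B_n$, where $A_0=1$, $A_1=a_0$, $B_0=0$, $B_1=1$, and $A_{n+1}=a_nA_n+b_nA_{n-1}$, $B_{n+1}=a_nB_n+b_nB_{n-1}$ for $n\ge1$. *)

(* Defs.v *)
(* Real numbers of the Stdlib, limits of Coquelicot. *)
From Stdlib Require Export Reals.
From Coquelicot Require Export Coquelicot.
Open Scope R_scope.

(* Numerators A_n and denominators B_n of the convergents of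
   a_0 + b_1/(a_1 + b_2/(a_2 + ...)). The indices are shifted by one with
   respect to the usual ones: A_1/B_1 = a_0, and B_0 = 0. The value [b 0] is
   never used. *)
Fixpoint cf_num (a b : nat -> R) (n : nat) : R :=
  match n with
  | O => 1
  | S m =>
      match m with
      | O => a O
      | S k => a m * cf_num a b m + b m * cf_num a b k
      end
  end.

Fixpoint cf_den (a b : nat -> R) (n : nat) : R :=
  match n with
  | O => 0
  | S m =>
      match m with
      | O => 1
      | S k => a m * cf_den a b m + b m * cf_den a b k
      end
  end.

(* Division is total, so the quotients A_n/B_n are required to be genuinely
   defined for all large n, in addition to converging to l. *)
Definition is_CF (a b : nat -> R) (l : R) : Prop :=
  eventually (fun n => cf_den a b n <> 0) /\
  is_lim_seq (fun n => cf_num a b n / cf_den a b n) (Finite l).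

(* Main.v *)
Require Import Defs.
From Stdlib Require Import Reals Factorial Lra Lia.
From Coquelicot Require Import Coquelicot.
Open Scope R_scope.

(** The numerators have the closed form
    [A_(m+1) = (m+1)! (2m-1)!! (m^2+5m+2) / 2]. Summing the Casoratian of [A]
    and [B] then gives [B_(m+1) / A_(m+1)] as
    [1/4 + (1/2) sum_(k=1..m) t_k / k^2] up to a multiple of [t_m], where
    [t_k = k! / (2k-1)!! = 2^k / binom(2k,k)]. The sum converges to [pi^2 / 8],
    by the expansion
    [x^2 = (1/2) sum_(k>=1) (t_k / k^2) (2 sin^2 x)^k] at [x = pi/4]: the second
    derivative of the remainder telescopes to [2 t_N (2 sin^2 x)^N]. *)

(** * The terms t_k and their geometric decay *)

Fixpoint odd_fact (n : nat) : R :=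
  match n with
  | O => 1
  | S m => (2 * INR m + 1) * odd_fact m
  end.

Definition fact_ratio (n : nat) : R := INR (fact n) / odd_fact n.

(** With z = sin x and y = 2 z^2, half of this is a partial sum of arcsin(z)^2 = (1/2) sum_(k>=1)
    (2z)^(2k) / (k^2 binom(2k,k)). *)
Fixpoint arcsin_sq_sum (n : nat) (y : R) : R :=
  match n with
  | O => 0
  | S m => arcsin_sq_sum m y + fact_ratio n / INR n ^ 2 * y ^ n
  end.

Lemma arcsin_sq_sum_S n y :
  arcsin_sq_sum (S n) y =
  arcsin_sq_sum n y + fact_ratio (S n) / INR (S n) ^ 2 * y ^ S n.
Proof. reflexivity. Qed.

Lemma odd_fact_S n : odd_fact (S n) = (2 * INR n + 1) * odd_fact n.
Proof. reflexivity. Qed.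

Lemma odd_fact_pos n : 0 < odd_fact n.
Proof.
induction n as [|n IH]; [simpl; lra|rewrite odd_fact_S].
assert (H := pos_INR n); apply Rmult_lt_0_compat; lra.
Qed.

Lemma fact_ratio_pos n : 0 < fact_ratio n.
Proof. apply Rdiv_lt_0_compat; [apply INR_fact_lt_0 | apply odd_fact_pos]. Qed.

Lemma fact_ratio_S n :
  fact_ratio (S n) = fact_ratio n * (INR n + 1) / (2 * INR n + 1).
Proof.
unfold fact_ratio; rewrite fact_simpl, mult_INR, S_INR, odd_fact_S.
assert (H := pos_INR n); assert (Ho := odd_fact_pos n).
field; split; lra.
Qed.

(** The ratio t_(n+1)/t_n = (n+1)/(2n+1) is at most 2/3 only from n = 1 on; the factor 3/2 absorbs
    the first step, where it is 1. *)
Lemma fact_ratio_le_geom n : fact_ratio n <= 3 / 2 * (2 / 3) ^ n.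
Proof.
destruct n as [|n]; [unfold fact_ratio; simpl; lra|].
induction n as [|n IH]; [unfold fact_ratio; simpl; lra|].
rewrite fact_ratio_S.
assert (H := pos_INR n); assert (Ht := fact_ratio_pos (S n)).
assert (Hr : (INR (S n) + 1) / (2 * INR (S n) + 1) <= 2 / 3).
{ rewrite S_INR; apply Rle_div_l; lra. }
apply (Rmult_le_compat_l (fact_ratio (S n))) in Hr; [|lra].
rewrite <- tech_pow_Rmult; lra.
Qed.

Lemma fact_ratio_lim : is_lim_seq fact_ratio 0.
Proof.
apply is_lim_seq_le_le with (fun _ => 0) (fun n => 3 / 2 * (2 / 3) ^ n).
- intros n; split; [apply Rlt_le, fact_ratio_pos | apply fact_ratio_le_geom].
- apply is_lim_seq_const.
- replace 0 with (3 / 2 * 0) by ring.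
  apply (is_lim_seq_scal_l _ (3 / 2) 0), is_lim_seq_geom.
  rewrite Rabs_pos_eq; lra.
Qed.

Lemma arcsin_sq_sum_nonneg n y : 0 <= y -> 0 <= arcsin_sq_sum n y.
Proof.
intros Hy; induction n as [|n IH]; [simpl; lra|rewrite arcsin_sq_sum_S].
apply Rplus_le_le_0_compat; [exact IH|].
apply Rmult_le_pos; [|apply (pow_le y (S n)), Hy].
apply Rlt_le, Rdiv_lt_0_compat; [apply fact_ratio_pos|].
apply pow_lt, (lt_0_INR (S n)); lia.
Qed.

(** * The arcsine-squared series at x = pi/4 *)

Lemma nonneg_of_derive (f df : R -> R) (b : R) :
  (forall x, is_derive f x (df x)) -> f 0 = 0 ->
  (forall x, 0 <= x <= b -> 0 <= df x) ->
  forall x, 0 <= x <= b -> 0 <= f x.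
Proof.
intros Hf Hf0 Hdf x Hx.
destruct (MVT_gen f 0 x df) as [c [Hc Heq]].
- intros u _; apply Hf.
- intros u _; apply continuity_pt_filterlim.
  apply (ex_derive_continuous f u); exists (df u); apply Hf.
- rewrite Rmin_left, Rmax_right in Hc by lra.
  rewrite Hf0 in Heq.
  assert (0 <= df c * (x - 0)) by (apply Rmult_le_pos; [apply Hdf|]; lra).
  lra.
Qed.

(** The new term c sin^(2n+2) x has second derivative c(2n+2)((2n+1) sin^(2n) x - (2n+2) sin^(2n+2)
    x). Its first part cancels the old second derivative, since (2n+1) t_(n+1) = (n+1) t_n, and its
    second part leaves the new one. *)
Lemma arcsin_sq_remainder n :
  exists df : R -> R,
    (forall x : R, is_derive (fun x => x ^ 2 - arcsin_sq_sum n (2 * sin x ^ 2) / 2) x (df x))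
    /\ df 0 = 0
    /\ (forall x : R, is_derive df x (2 * fact_ratio n * (2 * sin x ^ 2) ^ n)).
Proof.
induction n as [|n [df [Hf [H0 Hdf]]]].
- exists (fun x => 2 * x); split; [|split; [ring|]].
  + intros x; simpl arcsin_sq_sum; auto_derive; [easy|field].
  + intros x; unfold fact_ratio; simpl; auto_derive; [easy|field].
- assert (Hn := pos_INR n).
  (* The coefficient of sin^(2n+2) x in the term that the remainder loses from n to n+1. *)
  pose (c := 2 ^ S n * (fact_ratio (S n) / INR (S n) ^ 2) / 2).
  exists (fun x => df x - c * ((2 * INR n + 2) * (sin x ^ (2 * n + 1) * cos x))).
  split; [|split].
  + intros x.
    apply is_derive_ext with (fun x =>
      (x ^ 2 - arcsin_sq_sum n (2 * sin x ^ 2) / 2) - c * sin x ^ (2 * n + 2)).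
    { intros u; unfold c; rewrite arcsin_sq_sum_S.
      replace (2 * n + 2)%nat with (2 * S n)%nat by lia.
      rewrite pow_mult, Rpow_mult_distr.
      match goal with |- ?a = ?b => change (@eq R a b) end.
      unfold Rdiv; ring. }
    apply (is_derive_minus (fun x => x ^ 2 - arcsin_sq_sum n (2 * sin x ^ 2) / 2));
      [apply Hf|].
    auto_derive; [easy|].
    replace (Init.Nat.pred (n + (n + 0) + 2)) with (2 * n + 1)%nat by lia.
    rewrite !plus_INR; simpl INR; ring.
  + rewrite H0, sin_0, pow_ne_zero by lia; ring.
  + intros x.
    replace (2 * fact_ratio (S n) * (2 * sin x ^ 2) ^ S n) with
      (2 * fact_ratio n * (2 * sin x ^ 2) ^ n - c * ((2 * INR n + 2) *
        ((2 * INR n + 1) * sin x ^ (2 * n) * cos x ^ 2 - sin x ^ (2 * n + 2)))).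
    2:{ replace (2 * n + 2)%nat with (2 * S n)%nat by lia.
        rewrite !pow_mult, !Rpow_mult_distr; unfold c.
        rewrite fact_ratio_S, S_INR.
        replace (cos x ^ 2) with (1 - sin x ^ 2)
          by (generalize (sin2_cos2 x); unfold Rsqr; simpl; lra).
        simpl pow; field; lra. }
    apply (is_derive_minus df); [apply Hdf|].
    auto_derive; [easy|].
    replace (Init.Nat.pred (n + (n + 0) + 1)) with (2 * n)%nat by lia.
    replace (n + (n + 0) + 1)%nat with (S (2 * n)) by lia.
    replace (2 * n + 2)%nat with (S (S (2 * n))) by lia.
    rewrite S_INR, mult_INR, <- !tech_pow_Rmult; simpl (INR 2); ring.
Qed.

(** On [0, pi/4] the second derivative of the remainder lies between 0 and 2 t_n, because 2 sin^2 x
    <= 1 there. The remainder and its first derivative vanish at 0, so integrating twice puts it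
    between 0 and t_n x^2. *)
Lemma arcsin_sq_sum_bounds n :
  0 <= PI ^ 2 / 16 - arcsin_sq_sum n 1 / 2 <= fact_ratio n * (PI ^ 2 / 16).
Proof.
destruct (arcsin_sq_remainder n) as [df [Hf [H0 Hdf]]].
assert (Hpi := PI_RGT_0).
assert (Ht := fact_ratio_pos n).
assert (Hy4 : 2 * sin (PI / 4) ^ 2 = 1).
{ rewrite sin_PI4; unfold Rdiv; rewrite Rmult_1_l, pow_inv, pow2_sqrt; lra. }
assert (Hy : forall x, 0 <= x <= PI / 4 -> 0 <= 2 * sin x ^ 2 <= 1).
{ intros x Hx; split; [generalize (pow2_ge_0 (sin x)); lra|].
  assert (H1 : 0 <= sin x) by (apply sin_ge_0; lra).
  assert (H2 : sin x <= sin (PI / 4)) by (apply sin_incr_1; lra).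
  generalize (pow_incr _ _ 2 (conj H1 H2)); lra. }
assert (Hz : arcsin_sq_sum n 0 = 0).
{ clear; induction n as [|n IH]; simpl; [|rewrite IH]; ring. }
assert (Hf0 : 0 ^ 2 - arcsin_sq_sum n (2 * sin 0 ^ 2) / 2 = 0).
{ rewrite sin_0; replace (2 * 0 ^ 2) with 0 by ring; rewrite Hz; field. }
assert (Hyn : forall x, 0 <= x <= PI / 4 -> 0 <= (2 * sin x ^ 2) ^ n <= 1).
{ intros x Hx; destruct (Hy x Hx); split; [apply pow_le; lra|].
  rewrite <- (pow1 n); apply pow_incr; lra. }
assert (Hlo : 0 <= (PI / 4) ^ 2 - arcsin_sq_sum n (2 * sin (PI / 4) ^ 2) / 2).
{ apply (nonneg_of_derive _ _ (PI / 4) Hf Hf0); [|lra].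
  apply (nonneg_of_derive _ _ _ Hdf H0).
  intros x Hx; apply Rmult_le_pos; [lra|apply Hyn, Hx]. }
(* The same double integration, applied to t_n x^2 minus the remainder. *)
assert (Hhi : 0 <= fact_ratio n * (PI / 4) ^ 2 -
  ((PI / 4) ^ 2 - arcsin_sq_sum n (2 * sin (PI / 4) ^ 2) / 2)).
{ apply (nonneg_of_derive
    (fun x => fact_ratio n * x ^ 2 - (x ^ 2 - arcsin_sq_sum n (2 * sin x ^ 2) / 2))
    (fun x => 2 * fact_ratio n * x - df x) (PI / 4)); [| |  |lra].
  - intros x; apply (is_derive_minus (fun x => fact_ratio n * x ^ 2)); [|apply Hf].
    auto_derive; [easy|ring].
  - rewrite Hf0; ring.
  - apply (nonneg_of_derive _
      (fun x => 2 * fact_ratio n - 2 * fact_ratio n * (2 * sin x ^ 2) ^ n)).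
    + intros x; apply (is_derive_minus (fun x => 2 * fact_ratio n * x)); [|apply Hdf].
      auto_derive; [easy|ring].
    + rewrite H0; ring.
    + intros x Hx.
      replace (2 * fact_ratio n - 2 * fact_ratio n * (2 * sin x ^ 2) ^ n)
        with (2 * fact_ratio n * (1 - (2 * sin x ^ 2) ^ n)) by ring.
      generalize (Hyn x Hx); intros; apply Rmult_le_pos; lra. }
rewrite Hy4 in Hlo, Hhi.
replace ((PI / 4) ^ 2) with (PI ^ 2 / 16) in Hlo, Hhi by field.
lra.
Qed.

Lemma arcsin_sq_sum_lim : is_lim_seq (fun n => arcsin_sq_sum n 1) (PI ^ 2 / 8).
Proof.
apply is_lim_seq_le_le with
  (fun n => PI ^ 2 / 8 - PI ^ 2 / 8 * fact_ratio n) (fun _ => PI ^ 2 / 8).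
- intros n; generalize (arcsin_sq_sum_bounds n); lra.
- replace (Finite (PI ^ 2 / 8)) with (Finite (PI ^ 2 / 8 - PI ^ 2 / 8 * 0))
    by (f_equal; ring).
  apply is_lim_seq_minus'; [apply is_lim_seq_const|].
  apply (is_lim_seq_scal_l _ (PI ^ 2 / 8) 0), fact_ratio_lim.
- apply is_lim_seq_const.
Qed.

(** * Closed forms of the convergents *)

Lemma nat_pair_ind (P : nat -> Prop) :
  P O -> P 1%nat -> (forall n, P n -> P (S n) -> P (S (S n))) -> forall n, P n.
Proof.
intros H0 H1 HS n.
enough (P n /\ P (S n)) by easy.
induction n as [|n [IH1 IH2]]; auto.
Qed.

Notation cf_a := (fun n => 3 * INR n ^ 2 + 3 * INR n + 1).
Notation cf_b := (fun n => - (INR n ^ 3 * (2 * INR n - 3))).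

Lemma cf_num_closed m :
  cf_num cf_a cf_b (S m) =
  INR (fact (S m)) * odd_fact m * (INR m ^ 2 + 5 * INR m + 2) / 2.
Proof.
induction m as [| |m IH1 IH2] using nat_pair_ind; [simpl; field|simpl; field|].
change (cf_num cf_a cf_b (S (S (S m)))) with
  (cf_a (S (S m)) * cf_num cf_a cf_b (S (S m)) + cf_b (S (S m)) * cf_num cf_a cf_b (S m)).
rewrite IH1, IH2, (fact_simpl (S (S m))), (fact_simpl (S m)), !mult_INR.
rewrite !odd_fact_S, !S_INR; field.
Qed.

(** The last summand is the part of the Casoratian sum that telescopes; it equals 3/4 at m = 0, so
    B_1/A_1 = 1 forces the constant 1/4. *)
Definition cf_quot (m : nat) : R :=
  1 / 4 + arcsin_sq_sum m 1 / 2 +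
  fact_ratio m * ((INR m + 3) / (2 * (INR m + 1) * (INR m ^ 2 + 5 * INR m + 2))).

Lemma cf_den_closed m :
  cf_den cf_a cf_b (S m) = cf_num cf_a cf_b (S m) * cf_quot m.
Proof.
induction m as [| |m IH1 IH2] using nat_pair_ind.
- unfold cf_quot; simpl; unfold fact_ratio; simpl; field.
- unfold cf_quot; simpl; unfold fact_ratio; simpl; field.
- change (cf_den cf_a cf_b (S (S (S m)))) with
    (cf_a (S (S m)) * cf_den cf_a cf_b (S (S m)) + cf_b (S (S m)) * cf_den cf_a cf_b (S m)).
  rewrite IH1, IH2, !cf_num_closed, (fact_simpl (S (S m))), (fact_simpl (S m)), !mult_INR.
  assert (Hm := pos_INR m).
  (* Reducing the sums, t and the factorials to their values at the lowest index leaves an identity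
     of rational functions in m and those values. *)
  unfold cf_quot; rewrite !arcsin_sq_sum_S, !pow1, !Rmult_1_r.
  rewrite !fact_ratio_S.
  rewrite !odd_fact_S, !S_INR.
  field; repeat split; try nra.
Qed.

(** Together with the nonvanishing numerators, this keeps every B_(m+1) away from 0. *)
Lemma cf_quot_pos m : 0 < cf_quot m.
Proof.
assert (Hm := pos_INR m).
assert (Hs := arcsin_sq_sum_nonneg m 1 Rle_0_1).
assert (0 < fact_ratio m *
  ((INR m + 3) / (2 * (INR m + 1) * (INR m ^ 2 + 5 * INR m + 2)))).
{ apply Rmult_lt_0_compat; [apply fact_ratio_pos|].
  apply Rdiv_lt_0_compat; [lra|apply Rmult_lt_0_compat; nra]. }
unfold cf_quot; lra.
Qed.

Lemma cf_quot_lim : is_lim_seq cf_quot ((4 + PI ^ 2) / 16).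
Proof.
replace (Finite ((4 + PI ^ 2) / 16)) with (Finite (1 / 4 + PI ^ 2 / 8 / 2 + 0))
  by (f_equal; field).
apply is_lim_seq_plus'; [apply is_lim_seq_plus'; [apply is_lim_seq_const|]|].
- apply (is_lim_seq_scal_r _ (/ 2) (PI ^ 2 / 8)), arcsin_sq_sum_lim.
(* The rational factor lies in [0, 1], so the last summand is squeezed between 0 and t_m. *)
- apply is_lim_seq_le_le with (fun _ => 0) fact_ratio;
    [|apply is_lim_seq_const|apply fact_ratio_lim].
  intros m; assert (Hm := pos_INR m); assert (Ht := fact_ratio_pos m).
  assert (Hd : 0 < 2 * (INR m + 1) * (INR m ^ 2 + 5 * INR m + 2))
    by (apply Rmult_lt_0_compat; nra).
  assert (0 <= (INR m + 3) / (2 * (INR m + 1) * (INR m ^ 2 + 5 * INR m + 2)) <= 1).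
  { split; [apply Rlt_le, Rdiv_lt_0_compat; lra|].
    apply Rle_div_l; [exact Hd|nra]. }
  split; [apply Rmult_le_pos; lra|].
  rewrite <- (Rmult_1_r (fact_ratio m)) at 2; apply Rmult_le_compat_l; lra.
Qed.

Theorem corollary2p24 :
  is_CF (fun n => 3 * INR n ^ 2 + 3 * INR n + 1)
        (fun n => - (INR n ^ 3 * (2 * INR n - 3)))
        (16 / (4 + PI ^ 2)).
Proof.
assert (Hnum : forall m, cf_num cf_a cf_b (S m) <> 0).
{ intros m; rewrite cf_num_closed.
  assert (Hm := pos_INR m).
  apply Rgt_not_eq, Rdiv_lt_0_compat; [|lra].
  apply Rmult_lt_0_compat; [|nra].
  apply Rmult_lt_0_compat; [apply INR_fact_lt_0|apply odd_fact_pos]. }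
assert (Hq : forall m, cf_quot m <> 0)
  by (intros m; apply Rgt_not_eq, cf_quot_pos).
split.
(* Index 0 has to be excluded, as B_0 = 0. *)
- exists 1%nat; intros [|m] Hm; [lia|].
  rewrite cf_den_closed; apply Rmult_integral_contrapositive_currified; auto.
- apply is_lim_seq_incr_1.
  apply is_lim_seq_ext with (fun m => / cf_quot m).
  { intros m; rewrite cf_den_closed; field; auto. }
  assert (Hpi := pow2_ge_0 PI).
  replace (Finite (16 / (4 + PI ^ 2))) with (Rbar_inv ((4 + PI ^ 2) / 16))
    by (simpl; f_equal; simpl in Hpi; field; lra).
  apply is_lim_seq_inv; [apply cf_quot_lim|].
  intros [= H]; simpl in Hpi; lra.
Qed.
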